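(* Let $\nu<\kappa$ be infinite cardinals, let $J\in\mathcal J^\kappa_{\nu^+}$, and let $\mathcal A\subseteq[\kappa]^{\le\nu}$ be nonempty. Consider the collection $\mathcal J:=\{I\in\mathcal J^\kappa_{\nu^+}\mid I\supseteq J\}$. Then (with $\theta\geq 2$ ranging over cardinals): (1) For every $\theta\le\nu$, $\mathrm{unbounded}(\mathcal A,J,\theta)$ implies $\mathrm{unbounded}^+(\mathcal A,\mathcal J,\theta)$; (2) For every $\theta\le\kappa$, $\mathrm{onto}(\mathcal A,J,\theta)$ implies $\mathrm{onto}^+(\mathcal A,\mathcal J,\theta)$; (3) For every $\theta\le\kappa$, $\mathrm{onto}^{++}(\mathcal A,J,\theta)$ implies $\mathrm{onto}^{++}(\mathcal A,\mathcal J,\theta)$.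
   Context: An ideal over $\kappa$ is a nonempty family $J$ of subsets of $\kappa$ closed under subsets and finite unions; it is $\nu^+$-complete if it is closed under unions of at most $\nu$ of its members; $J^+:=\mathcal P(\kappa)\setminus J$. $\mathcal J^\kappa_{\nu^+}$ is the collection of all $\nu^+$-complete ideals over $\kappa$ containing all bounded subsets of $\kappa$. $[\kappa]^{\le\nu}$ is the collection of subsets of $\kappa$ of size at most $\nu$. $[\kappa]^2$ is identified with the set of pairs $(\alpha,\beta)$ with $\alpha<\beta<\kappa$. A colouring $c:[\kappa]^2\to\theta$ is upper-regressive if $c(\alpha,\beta)<\beta$ for all $\alpha<\beta<\kappa$. For $\mathcal A\subseteq\mathcal P(\kappa)$, an ideal $J$ over $\kappa$ and a cardinal $2\le\theta\le\kappa$, each of the following principles asserts the existence of a colouring $c:[\kappa]^2\to\theta$ (required to be upper-regressive for the ''unbounded'' principles) with the stated property: - $\mathrm{onto}^{++}(\mathcal A,J,\theta)$: for every $A\in\mathcal A$ and every sequence $\langle B_\tau\mid\tau<\theta\rangle$ of elements of $J^+$ there is $\eta\in A$ such that $\{\beta\in B_\tau\setminus(\eta+1)\mid c(\eta,\beta)=\tau\}\in J^+$ for every $\tau<\theta$. - $\mathrm{onto}^+(\mathcal A,J,\theta)$: for all $A\in\mathcal A$ and $B\in J^+$ there is $\eta\in A$ such that $\{\beta\in B\setminus(\eta+1)\mid c(\eta,\beta)=\tau\}\in J^+$ for every $\tau<\theta$. - $\mathrm{onto}(\mathcal A,J,\theta)$: for all $A\in\mathcal A$ and $B\in J^+$ there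 is $\eta\in A$ such that $\{c(\eta,\beta)\mid\beta\in B,\ \beta>\eta\}=\theta$. - $\mathrm{unbounded}^+(\mathcal A,J,\theta)$: for all $A\in\mathcal A$ and $B\in J^+$ there is $\eta\in A$ such that $\mathrm{otp}(\{\tau<\theta\mid\{\beta\in B\setminus(\eta+1)\mid c(\eta,\beta)=\tau\}\in J^+\})=\theta$. - $\mathrm{unbounded}(\mathcal A,J,\theta)$: for all $A\in\mathcal A$ and $B\in J^+$ there is $\eta\in A$ such that $\mathrm{otp}(\{c(\eta,\beta)\mid\beta\in B,\ \beta>\eta\})=\theta$. If $J$ is replaced by a collection $\mathcal J$ of ideals over $\kappa$, the principle asserts that one single colouring has the property for all $J\in\mathcal J$ simultaneously. *)

(* Defs.v *)
From HB Require Import structures.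
From mathcomp Require Import all_boot all_order.
From mathcomp Require Export boolp classical_sets functions cardinality.

Set Implicit Arguments.
Unset Strict Implicit.
Unset Printing Implicit Defensive.

Local Open Scope classical_set_scope.
Local Open Scope card_scope.
Local Open Scope order_scope.

(* The ordinal kappa is a well-ordered type K.  As with von Neumann ordinals,
   an ordinal alpha <= kappa is the set of its predecessors, that is, an initial
   segment of K: kappa is setT, the ordinal x : K is below x, and the order on
   ordinals is inclusion. *)
Section Principles.
Context {d : Order.disp_t} {K : orderType d}.
Implicit Types (X Y A B nu theta : set K) (J : set (set K)).
Implicit Types (AA : set (set K)) (JJ : set (set (set K))).
Implicit Types (c : K -> K -> K).

Definition below (x : K) : set K := [set y | y < x].

Definition is_ordinal X := forall x y, X y -> x < y -> X x.

(* Finite cardinals, including 0, are allowed. *)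
Definition is_cardinal X :=
  is_ordinal X /\ forall x, X x -> ~ (below x #= X).

Definition is_ideal J :=
  [/\ J !=set0,
      (forall X Y, X `<=` Y -> J Y -> J X) &
      (forall X Y, J X -> J Y -> J (X `|` Y))].

Definition succ_complete nu J :=
  forall F : set (set K), F `<=` J -> F #<= nu -> J (\bigcup_(X in F) X).

Definition bounded_subset X := exists x, X `<=` below x.

Definition ideals_over nu : set (set (set K)) :=
  [set J | [/\ is_ideal J, succ_complete nu J & bounded_subset `<=` J]].

Definition positive J : set (set K) := ~` J.

Definition subsets_of_size_le nu : set (set K) := [set A | A #<= nu].

(* otp X = theta, for an ordinal theta. *)
Definition has_otp X theta :=
  exists f : K -> K,
    set_bij X theta f /\ forall x y, X x -> X y -> x < y -> f x < f y.

(* A colouring of [kappa]^2 is given by a map c of which only the values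
   c alpha beta with alpha < beta are ever used. *)
Definition colouring theta c :=
  forall alpha beta, alpha < beta -> theta (c alpha beta).

Definition upper_regressive c :=
  forall alpha beta, alpha < beta -> c alpha beta < beta.

(* {beta in B \ (eta + 1) | c(eta, beta) = tau} *)
Definition colour_class c B (eta tau : K) : set K :=
  [set beta | [/\ B beta, eta < beta & c eta beta = tau]].

(* {c(eta, beta) | beta in B, beta > eta} *)
Definition colours c B (eta : K) : set K :=
  [set c eta beta | beta in [set beta | B beta /\ eta < beta]].

(* All principles are stated for a collection JJ of ideals; the principle for a
   single ideal J is the case JJ = [set J]. *)
Definition onto_pp AA JJ theta :=
  exists2 c, colouring theta c &
    forall J, JJ J -> forall A, AA A ->
    forall B : K -> set K, (forall tau, theta tau -> positive J (B tau)) ->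
    exists2 eta, A eta &
      forall tau, theta tau -> positive J (colour_class c (B tau) eta tau).

Definition onto_p AA JJ theta :=
  exists2 c, colouring theta c &
    forall J, JJ J -> forall A B, AA A -> positive J B ->
    exists2 eta, A eta &
      forall tau, theta tau -> positive J (colour_class c B eta tau).

Definition onto AA JJ theta :=
  exists2 c, colouring theta c &
    forall J, JJ J -> forall A B, AA A -> positive J B ->
    exists2 eta, A eta & colours c B eta = theta.

Definition unbounded_p AA JJ theta :=
  exists2 c, colouring theta c /\ upper_regressive c &
    forall J, JJ J -> forall A B, AA A -> positive J B ->
    exists2 eta, A eta &
      has_otp [set tau | theta tau /\ positive J (colour_class c B eta tau)]
              theta.

Definition unbounded AA JJ theta :=
  exists2 c, colouring theta c /\ upper_regressive c &
    forall J, JJ J -> forall A B, AA A -> positive J B ->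
    exists2 eta, A eta & has_otp (colours c B eta) theta.

End Principles.

(* Main.v *)
(** Any colouring witnessing the hypothesis also witnesses the conclusion.  If
    it failed for some [I] extending [J] and some [A], then each [eta] in [A]
    would have [I]-small colour classes spoiling it; as [A] has size at most
    [nu], the union of these classes is in [I], so removing it leaves an
    [I]-positive, hence [J]-positive, set to which the hypothesis applies,
    yielding an [eta] in [A] that realises a removed colour.  For (1), all the
    small classes are removed, so that the colours realised afterwards have
    positive classes; as [theta] is a cardinal, a subset of [theta] of full
    cardinality has order type [theta]. *)
Require Import Defs.
From mathcomp Require Import all_boot all_order.

Import Order.TTheory.

Local Open Scope classical_set_scope.
Local Open Scope card_scope.

Section OrderType.
Context {d : Order.disp_t} {K : orderType d}.
Hypothesis Kwf : well_founded (fun x y : K => (x < y)%O).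
Implicit Types (P T X theta : set K).

Lemma wf_least P : P !=set0 -> exists2 y, P y & forall z, P z -> (y <= z)%O.
Proof.
move=> [x]; elim/(well_founded_ind Kwf): x => x IH Px.
have [[z [Pz zx]]|nz] := pselect (exists z, P z /\ (z < x)%O); first exact: IH Pz.
exists x => // z Pz; rewrite leNgt; apply/negP => zx.
by apply: nz; exists z.
Qed.

Definition least (x0 : K) P : K :=
  xget x0 [set y | P y /\ forall z, P z -> (y <= z)%O].

Lemma leastP x0 P : P !=set0 ->
  P (least x0 P) /\ forall z, P z -> (least x0 P <= z)%O.
Proof.
move=> /wf_least [y Py ymin]; rewrite /least.
by case: xgetP => [_ -> //|/(_ y)]; case; split.
Qed.

(** The Mostowski collapse of [T], extended to all of [K]: [x] goes to the least strict upper bound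
    of the values at elements of [T] below [x]. The default [x] in [least] is never reached, since
    [x] is itself such a bound. *)
Definition collapse T : K -> K :=
  Fix Kwf (fun=> K) (fun x f =>
    least x [set y | forall z (zx : (z < x)%O), T z -> (f z zx < y)%O]).

Lemma collapseE T x : collapse T x =
  least x [set y | forall z, (z < x)%O -> T z -> (collapse T z < y)%O].
Proof.
rewrite {1}/collapse Fix_eq // => {}x f g fg.
by congr least; apply/funext => y; apply/propext; split => + z zx;
  [rewrite -fg|rewrite fg]; apply.
Qed.

Lemma collapse_le T x : (collapse T x <= x)%O.
Proof.
elim/(well_founded_ind Kwf): x => x IH; rewrite collapseE.
have ubx : [set y | forall z, (z < x)%O -> T z -> (collapse T z < y)%O] x.
  by move=> z zx _; exact: le_lt_trans (IH z zx) zx.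
exact: (leastP x _ (ex_intro _ x ubx)).2 ubx.
Qed.

Lemma collapseP T x :
  (forall z, (z < x)%O -> T z -> (collapse T z < collapse T x)%O) /\
  (forall y, (forall z, (z < x)%O -> T z -> (collapse T z < y)%O) ->
     (collapse T x <= y)%O).
Proof.
rewrite [collapse T x]collapseE; apply: leastP; exists x => z zx _.
exact: le_lt_trans (collapse_le T z) zx.
Qed.

(** If [y] is below the value at [x], minimality of that value yields [z] in [T] below [x] whose
    value is at least [y]; either it equals [y], or induction applies to [z]. *)
Lemma collapse_ordinal T : is_ordinal (collapse T @` T).
Proof.
move=> y _ [x Tx <-]; elim/(well_founded_ind Kwf): x Tx => x IH Tx yx.
have [[z [zx Tz]]|nz] :=
    pselect (exists z, [/\ (z < x)%O, T z & (y <= collapse T z)%O]).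
  by rewrite le_eqVlt => /orP[/eqP->|]; [exists z|exact: IH].
suff : (collapse T x <= y)%O by rewrite leNgt yx.
apply: (collapseP T x).2 => z zx Tz; rewrite ltNge; apply/negP => yz.
by apply: nz; exists z.
Qed.

(** The collapse is the required isomorphism. Were some [z] in [theta] missed, the image, being an
    initial segment, would lie in [below z], and [theta] would inject into a proper initial segment
    of itself. *)
Lemma has_otp_cardinal {theta T} : is_cardinal theta -> T `<=` theta ->
  theta #<= T -> has_otp T theta.
Proof.
move=> [theta_ord theta_card] Ttheta le_theta.
have incr x y : T x -> (x < y)%O -> (collapse T x < collapse T y)%O.
  by move=> Tx xy; exact: (collapseP T y).1.
have inj : set_inj T (collapse T).
  move=> x y /set_mem Tx /set_mem Ty e.
  by case: (ltgtP x y) => // [/(incr _ _ Tx)|/(incr _ _ Ty)]; rewrite e ltxx.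
have im : set_fun T theta (collapse T).
  move=> x Tx; have := collapse_le T x; rewrite le_eqVlt => /orP[/eqP->|].
    exact: Ttheta.
  by apply: theta_ord; exact: Ttheta.
exists (collapse T); split; last by move=> x y Tx _; exact: incr.
split=> // z thz; apply: contrapT => nz.
have im_z : collapse T @` T `<=` below z.
  move=> y Ty; rewrite /below /= ltNge le_eqVlt; apply/negP => /orP[/eqP zy|zy].
    by apply: nz; rewrite zy.
  by apply: nz; exact: collapse_ordinal Ty zy.
apply: (theta_card z thz); rewrite card_eq_le; apply/andP; split.
  by apply: subset_card_le => y; exact: theta_ord.
apply: card_le_trans le_theta (card_le_trans _ (subset_card_le im_z)).
by have /card_eqPle[] := inj_card_eq inj.
Qed.

End OrderType.

Section Ideals.
Context {d : Order.disp_t} {K : orderType d}.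
Context {nu : set K} {I : set (set K)}.
Hypothesis I_over : ideals_over nu I.

Lemma ideal_subset X Y : X `<=` Y -> I Y -> I X.
Proof. by case: I_over => -[_ + _] _ _; apply. Qed.

Lemma ideal_bigcup {D : set K} {F : K -> set K} : D #<= nu ->
  (forall i, D i -> I (F i)) -> I (\bigcup_(i in D) F i).
Proof.
move=> Dnu IF; rewrite -[X in I X](bigcup_image D F id).
case: I_over => _ + _; apply; first by move=> _ [i Di <-]; exact: IF.
exact: card_le_trans (card_image_le _ _) Dnu.
Qed.

Lemma positive_setD {B X : set K} : positive I B -> I X -> positive I (B `\` X).
Proof.
move=> IB IX IBX; apply: IB; case: I_over => -[_ _ IU] _ _.
apply: ideal_subset (IU _ _ IBX IX) => x Bx.
by have [Xx|nXx] := pselect (X x); [right|left].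
Qed.

End Ideals.

Theorem proposition2p9 (d : Order.disp_t) (K : orderType d)
    (Kwf : well_founded (fun x y : K => (x < y)%O))
    (Kcard : is_cardinal [set: K]) (Kinf : infinite_set [set: K])
    (nu : set K) (nucard : is_cardinal nu) (nuinf : infinite_set nu)
    (nu_lt : nu `<` [set: K])
    (J : set (set K)) (HJ : ideals_over nu J)
    (AA : set (set K)) (HAA : AA `<=` subsets_of_size_le nu)
    (AA0 : AA !=set0) :
  let JJ := [set I : set (set K) | ideals_over nu I /\ J `<=` I] in
  [/\ (forall theta : set K, is_cardinal theta -> `I_2 #<= theta ->
         theta `<=` nu ->
         unbounded AA [set J] theta -> unbounded_p AA JJ theta),
      (forall theta : set K, is_cardinal theta -> `I_2 #<= theta ->
         theta `<=` [set: K] ->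
         onto AA [set J] theta -> onto_p AA JJ theta) &
      (forall theta : set K, is_cardinal theta -> `I_2 #<= theta ->
         theta `<=` [set: K] ->
         onto_pp AA [set J] theta -> onto_pp AA JJ theta)].
Proof.
move=> JJ; split=> theta theta_card _ theta_le [c c_col c_wit]; exists c => //
  I [I_over JI] A.
- move=> B AAA IB.
  pose T eta := [set tau | theta tau /\ positive I (colour_class c B eta tau)].
  (* Two successive unions of length at most [nu] avoid [nu * nu = nu]. *)
  pose small eta := \bigcup_(tau in theta `\` T eta) colour_class c B eta tau.
  have I_small eta : I (small eta).
    apply: (ideal_bigcup I_over) => [|tau [thtau nT]].
      by apply: subset_card_le => tau [thtau _]; exact: theta_le.
    by apply: contrapT => nI; apply: nT.
  have IB' := positive_setD I_over IB
    (ideal_bigcup I_over (HAA _ AAA) (fun eta _ => I_small eta)).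
  have JB' : positive J (B `\` \bigcup_(eta in A) small eta) by move=> /JI.
  have [eta Aeta [f [[_ _ f_surj] _]]] := c_wit _ erefl _ _ AAA JB'.
  exists eta => //; apply: (has_otp_cardinal Kwf theta_card) => [tau []//|].
  (* Surjectivity of [f] bounds [theta] by the set of colours realised on the reduced set, all of
     which lie in [T eta]. *)
  apply: card_le_trans (subset_card_le f_surj) _.
  apply: card_le_trans (card_image_le _ _) _.
  apply: subset_card_le => _ [beta [[Bbeta nsmall] eta_beta] <-].
  have thtau : theta (c eta beta) by case: c_col => + _; apply.
  apply: contrapT => nT; apply: nsmall.
  by exists eta => //; exists (c eta beta).
- move=> B AAA IB; apply: contrapT => no_eta.
  (* With [A eta] under the existential, choice gives a total function [t], arbitrary outside
     [A]. *)
  have bad eta : exists tau, A eta ->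
      theta tau /\ I (colour_class c B eta tau).
    apply: contrapT => nbad; apply: no_eta; exists eta.
      by apply: contrapT => nA; apply: nbad; exists eta.
    by move=> tau thtau Itau; apply: nbad; exists tau.
  have [t t_bad] := choice bad.
  have IB' := positive_setD I_over IB
    (ideal_bigcup I_over (HAA _ AAA) (fun eta Aeta => (t_bad eta Aeta).2)).
  have [eta Aeta eq_theta] := c_wit _ erefl _ _ AAA (fun H => IB' (JI _ H)).
  have := (t_bad eta Aeta).1; rewrite -{1}eq_theta.
  move=> [beta [[Bbeta nU] eta_beta] ctau].
  by apply: nU; exists eta.
- move=> AAA B IB; apply: contrapT => no_eta.
  have bad eta : exists tau, A eta ->
      theta tau /\ I (colour_class c (B tau) eta tau).
    apply: contrapT => nbad; apply: no_eta; exists eta.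
      by apply: contrapT => nA; apply: nbad; exists eta.
    by move=> tau thtau Itau; apply: nbad; exists tau.
  have [t t_bad] := choice bad.
  have IU := ideal_bigcup I_over (HAA _ AAA)
    (fun eta Aeta => (t_bad eta Aeta).2).
  (* One and the same union, built from classes in the various [B (t eta)], is removed from every
     [B tau]. *)
  have [|eta Aeta /(_ _ (t_bad eta Aeta).1)] := c_wit _ erefl _ AAA
    (fun tau => B tau `\` \bigcup_(eta in A) colour_class c (B (t eta)) eta (t eta)).
    by move=> tau thtau /JI; exact: (positive_setD I_over (IB _ thtau) IU).
  (* The class of colour [t eta] in the reduced [B (t eta)] is empty, hence in [J] as a subset of
     the bounded set [below eta]. *)
  apply; have J_below : J (below eta) by case: HJ => _ _; apply; exists eta.
  apply: (ideal_subset HJ _ _ _ J_below) => beta [[Bbeta nU] eta_beta ctau].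
  by case: nU; exists eta.
Qed.
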